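(* Let $\lambda\in\mathbb{K}$, let $(A,\mathcal{I})$ be a $\lambda$-weighted Rota-Baxter Jacobi-Jordan algebra and let $(V,\mathcal{T})$ (with action $\rho$) be a representation of $(A,\mathcal{I})$. Define $\bar\rho:A\to gl(V)$ by $\bar\rho(x)(u):=\rho(\mathcal{I}x)(u)+\rho(x)(\mathcal{T}(u))+\lambda\rho(x)(u)$ for all $x\in A$, $u\in V$. Then: (i) $\mathcal{T}(\bar\rho(x)u)=\rho(\mathcal{I}x)\mathcal{T}(u)$ for all $x\in A$, $u\in V$. (ii) $(\bar V=(V,\bar\rho),\mathcal{T})$ is a representation of the $\lambda$-weighted Rota-Baxter Jacobi-Jordan algebra $(A_{\mathcal{I}},\mathcal{I})$.
   Context: $\mathbb{K}$ is a field of characteristic $0$; all vector spaces and linear maps are over $\mathbb{K}$; $gl(V)$ denotes the space of linear endomorphisms of $V$. A Jacobi-Jordan algebra is a vector space $A$ with a bilinear product $\ast$ such that $x\ast y=y\ast x$ and $(x\ast y)\ast z+(y\ast z)\ast x+(z\ast x)\ast y=0$ for all $x,y,z\in A$. A $\lambda$-weighted Rota-Baxter operator on $(A,\ast)$ is a linear map $\mathcal{I}:A\to A$ with $\mathcal{I}(x)\ast\mathcal{I}(y)=\mathcal{I}(\mathcal{I}(x)\ast y+x\ast\mathcal{I}(y)+\lambda(x\ast y))$ for all $x,y\in A$; then $(A,\mathcal{I})$ is called a $\lambda$-weighted Rota-Baxter Jacobi-Jordan algebra. A representation of a Jacobi-Jordan algebra $A$ is a vector space $V$ with a linear map $\rho:A\to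 gl(V)$ such that $\rho(x\ast y)=-\rho(x)\rho(y)-\rho(y)\rho(x)$ for all $x,y\in A$. A representation of $(A,\mathcal{I})$ is a triple $(V,\rho,\mathcal{T})$, written $(V,\mathcal{T})$, where $(V,\rho)$ is a representation of the Jacobi-Jordan algebra $A$ and $\mathcal{T}:V\to V$ is linear with $\rho(\mathcal{I}x)(\mathcal{T}u)=\mathcal{T}(\rho(\mathcal{I}x)u+\rho(x)(\mathcal{T}u)+\lambda\rho(x)u)$ for all $x\in A$, $u\in V$. $A_{\mathcal{I}}$ denotes the vector space $A$ with the product $x\ast_{\mathcal{I}}y:=\mathcal{I}(x)\ast y+x\ast\mathcal{I}(y)+\lambda(x\ast y)$; it is a Jacobi-Jordan algebra and $(A_{\mathcal{I}},\mathcal{I})$ is a $\lambda$-weighted Rota-Baxter Jacobi-Jordan algebra. *)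

(* Defs.v *)
From mathcomp Require Import all_boot all_algebra.

Set Implicit Arguments.
Unset Strict Implicit.
Unset Printing Implicit Defensive.

Import GRing.Theory.
Local Open Scope ring_scope.

Section Definitions.
Variables (K : fieldType) (A V : lmodType K).

(* Algebra structures are predicates on an explicit product, since one carrier
   A bears both the given product and the product of A_I. *)
Record is_jacobi_jordan (mul : A -> A -> A) : Prop := IsJacobiJordan {
  jj_bilinear : bilinear_for *:%R *:%R mul;
  jj_comm : commutative mul;
  jj_jacobi : forall x y z,
    mul (mul x y) z + mul (mul y z) x + mul (mul z x) y = 0
}.

Record is_rota_baxter (lam : K) (mul : A -> A -> A) (I : A -> A) : Prop :=
  IsRotaBaxter {
  rb_linear : linear I;
  rb_eq : forall x y,
    mul (I x) (I y) = I (mul (I x) y + mul x (I y) + lam *: mul x y)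
}.

Record is_rb_jacobi_jordan (lam : K) (mul : A -> A -> A) (I : A -> A) : Prop :=
  IsRBJacobiJordan {
  rbjj_jacobi_jordan : is_jacobi_jordan mul;
  rbjj_rota_baxter : is_rota_baxter lam mul I
}.

(* A linear map A -> gl(V) is encoded in curried form, as a map A -> V -> V
   that is linear in each argument. *)
Record is_representation (mul : A -> A -> A) (rho : A -> V -> V) : Prop :=
  IsRepresentation {
  rep_bilinear : bilinear_for *:%R *:%R rho;
  rep_mul : forall x y u,
    rho (mul x y) u = - rho x (rho y u) - rho y (rho x u)
}.

Record is_rb_representation (lam : K) (mul : A -> A -> A) (I : A -> A)
    (rho : A -> V -> V) (T : V -> V) : Prop := IsRBRepresentation {
  rbrep_representation : is_representation mul rho;
  rbrep_linear : linear T;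
  rbrep_eq : forall x u,
    rho (I x) (T u) = T (rho (I x) u + rho x (T u) + lam *: rho x u)
}.

(* The product of A_I. *)
Definition rb_mul (lam : K) (mul : A -> A -> A) (I : A -> A) (x y : A) : A :=
  mul (I x) y + mul x (I y) + lam *: mul x y.

Definition rb_action (lam : K) (I : A -> A) (rho : A -> V -> V) (T : V -> V)
    (x : A) (u : V) : V :=
  rho (I x) u + rho x (T u) + lam *: rho x u.

End Definitions.

(* Main.v *)
Require Import Defs.
From mathcomp Require Import all_boot all_algebra.

(** With S := T + lam id, the new action is rb_action x u = rho (I x) u +
    rho x (S u), and T intertwines it with rho (I x), by the Rota-Baxter
    identity for T read from right to left.  Consequently S (rb_action y u) =
    rho (I y) (S u) + lam rho y (S u), so that composing two new actions yields
    one term in u and three in S u: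
      rho (I x) (rho (I y) u) + rho (I x) (rho y (S u))
        + rho x (rho (I y) (S u)) + lam rho x (rho y (S u)).
    As I (rb_mul x y) = mul (I x) (I y), the action of rb_mul x y likewise has
    the terms rho (mul (I x) (I y)) u and rho (mul (I x) y) (S u),
    rho (mul x (I y)) (S u), lam rho (mul x y) (S u), so the representation
    identity for rho matches them one by one with the terms of the two
    compositions.

    That A_I is itself a Rota-Baxter Jacobi-Jordan algebra is the same fact once
    more: a commutative product satisfies the Jacobi identity exactly when it is
    a representation of itself by multiplication, the Rota-Baxter identity for I
    is then the compatibility of this regular representation with T := I, and
    the action that the construction gives for it is the product of A_I. *)

Set Implicit Arguments.
Unset Strict Implicit.
Unset Printing Implicit Defensive.

Import GRing.Theory.
Local Open Scope ring_scope.

Section BilinearMaps.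
Variables (K : fieldType) (A V : lmodType K) (rho : A -> V -> V).
Hypothesis rho_bilinear : bilinear_for *:%R *:%R rho.

Lemma bilinear_addl x y u : rho (x + y) u = rho x u + rho y u.
Proof. by have := rho_bilinear.1 u 1 x y; rewrite /= !scale1r. Qed.

Lemma bilinear_addr x u v : rho x (u + v) = rho x u + rho x v.
Proof. by have := rho_bilinear.2 x 1 u v; rewrite /= !scale1r. Qed.

Lemma bilinear_scalel a x u : rho (a *: x) u = a *: rho x u.
Proof.
have rho0 : rho 0 u = 0.
  by apply: (@addrI _ (rho 0 u)); rewrite -bilinear_addl !addr0.
by have := rho_bilinear.1 u a x 0; rewrite /= rho0 !addr0.
Qed.

Lemma bilinear_scaler a x u : rho x (a *: u) = a *: rho x u.
Proof.
have rho0 : rho x 0 = 0.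
  by apply: (@addrI _ (rho x 0)); rewrite -bilinear_addr !addr0.
by have := rho_bilinear.2 x a u 0; rewrite /= rho0 !addr0.
Qed.

End BilinearMaps.

Section LinearMaps.
Variables (K : fieldType) (V : lmodType K) (T : V -> V).
Hypothesis T_linear : linear T.

Lemma linear_add u v : T (u + v) = T u + T v.
Proof. by have := T_linear 1 u v; rewrite /= !scale1r. Qed.

Lemma linear_scale a u : T (a *: u) = a *: T u.
Proof.
have T0 : T 0 = 0 by apply: (@addrI _ (T 0)); rewrite -linear_add !addr0.
by have := T_linear a u 0; rewrite /= T0 !addr0.
Qed.

End LinearMaps.

Section RotaBaxterAction.
Variables (K : fieldType) (lam : K) (A V : lmodType K).
Variables (mul : A -> A -> A) (I : A -> A) (rho : A -> V -> V) (T : V -> V).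
Hypothesis I_rota_baxter : is_rota_baxter lam mul I.
Hypothesis rho_rep : is_rb_representation lam mul I rho T.

Let rho_bil := rep_bilinear (rbrep_representation rho_rep).
Let T_lin := rbrep_linear rho_rep.
Let I_lin := rb_linear I_rota_baxter.
Let rhoDl := bilinear_addl rho_bil.
Let rhoDr := bilinear_addr rho_bil.
Let rhoZl := bilinear_scalel rho_bil.
Let rhoZr := bilinear_scaler rho_bil.
Let TD := linear_add T_lin.
Let TZ := linear_scale T_lin.

(** Absorbs the weight: the two terms of rb_action that apply rho x become the
    single term rho x (S u). *)
Let S u := T u + lam *: u.

Local Notation rhobar := (rb_action lam I rho T).

Lemma rb_action_intertwine x u : T (rhobar x u) = rho (I x) (T u).
Proof. by rewrite (rbrep_eq rho_rep). Qed.

Lemma rb_actionE x u : rhobar x u = rho (I x) u + rho x (S u).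
Proof. by rewrite /rb_action /S rhoDr rhoZr addrA. Qed.

Lemma shift_linear : linear S.
Proof.
move=> a u v; rewrite /S TD TZ !scalerDr !scalerA (mulrC lam a) -!addrA.
by congr (_ + _); rewrite addrCA.
Qed.

(** The term lam u of S u is not intertwined by rho (I y): it keeps a whole copy
    of the new action, whose part in rho (I y) turns T u into S u and whose part
    in rho y remains. *)
Lemma shift_rb_action y u :
  S (rhobar y u) = rho (I y) (S u) + lam *: rho y (S u).
Proof.
rewrite {1}/S rb_action_intertwine rb_actionE scalerDr addrA.
by rewrite {2}/S rhoDr rhoZr.
Qed.

Lemma rb_action_comp x y u :
  rhobar x (rhobar y u) =
    rho (I x) (rho (I y) u) + rho (I x) (rho y (S u))
    + (rho x (rho (I y) (S u)) + lam *: rho x (rho y (S u))).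
Proof.
rewrite rb_actionE shift_rb_action (rb_actionE y u).
by move: (S u) => v; rewrite !rhoDr rhoZr.
Qed.

Lemma rb_action_bilinear : bilinear_for *:%R *:%R rhobar.
Proof.
split=> [u a x y | x a u v].
  rewrite /= !rb_actionE (linear_add I_lin) (linear_scale I_lin).
  by rewrite !rhoDl !rhoZl scalerDr addrACA.
rewrite /= !rb_actionE shift_linear; move: (S u) (S v) => u' v'.
by rewrite !rhoDr !rhoZr scalerDr addrACA.
Qed.

Lemma rb_action_representation :
  is_representation (rb_mul lam mul I) rhobar.
Proof.
split=> [|x y u]; first exact: rb_action_bilinear.
have rhoM z w v : rho (mul z w) v = - (rho z (rho w v) + rho w (rho z v)).
  by rewrite (rep_mul (rbrep_representation rho_rep)) opprD.
rewrite -opprD !rb_action_comp rb_actionE -(rb_eq I_rota_baxter).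
move: (S u) => v; rewrite /rb_mul !rhoDl rhoZl !rhoM.
rewrite scalerN -!opprD; congr (- _); rewrite scalerDr.
(* The operator applied last, carrying x or y, tells which of the two
   compositions a term belongs to: each rho (mul z w) feeds one to each. *)
by rewrite [LHS](AC (2*((2*2)*2)) (((1*3)*(5*7))*((2*6)*(4*8)))).
Qed.

Lemma rb_action_rb_representation :
  is_rb_representation lam (rb_mul lam mul I) I rhobar T.
Proof.
split=> [||x u]; first exact: rb_action_representation.
  exact: T_lin.
by rewrite TD (TD (rhobar _ _)) TZ !rb_action_intertwine.
Qed.

End RotaBaxterAction.

Section RegularRepresentation.
Variables (K : fieldType) (A : lmodType K) (mul : A -> A -> A).

(** For a commutative product the Jacobi identity says that multiplying by
    mul x y is minus the sum of the two composed multiplications. *)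
Lemma jacobi_jordan_regularP :
  is_jacobi_jordan mul <-> commutative mul /\ is_representation mul mul.
Proof.
split=> [[mul_bil mulC jacobi] | [mulC [mul_bil mul_rep]]].
  split=> //; split=> // x y z; apply/eqP; rewrite -opprD -addr_eq0 addrA.
  rewrite addrAC -(jacobi x y z) [mul x (mul y z)]mulC [mul y (mul x z)]mulC.
  by rewrite [mul x z]mulC addrAC.
split=> // x y z; rewrite mul_rep [mul (mul y z) x]mulC [mul (mul z x) y]mulC.
by rewrite [mul z x]mulC addrAC subrK addNr.
Qed.

Variables (lam : K) (I : A -> A).

Lemma regular_rb_representation :
  is_rb_jacobi_jordan lam mul I -> is_rb_representation lam mul I mul I.
Proof.
case=> /jacobi_jordan_regularP[_ mul_rep] [I_lin I_eq].
by split.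
Qed.

Lemma rb_mul_commutative : commutative mul -> commutative (rb_mul lam mul I).
Proof.
move=> mulC x y.
by rewrite /rb_mul (mulC (I x)) (mulC x (I y)) (mulC x y) [X in X + _]addrC.
Qed.

End RegularRepresentation.

(** The action built from the regular representation is the product of A_I, so
    what is known of the action applies to the product. *)
Lemma rb_mul_rb_jacobi_jordan (K : fieldType) (A : lmodType K) (lam : K)
    (mul : A -> A -> A) (I : A -> A) :
  is_rb_jacobi_jordan lam mul I ->
  is_rb_jacobi_jordan lam (rb_mul lam mul I) I.
Proof.
move=> hA; have [/jj_comm mulC hI] := hA.
have [mulI_rep I_lin I_eq] :=
  rb_action_rb_representation hI (regular_rb_representation hA).
split; last by split.
by apply/jacobi_jordan_regularP; split; first exact: rb_mul_commutative.
Qed.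

Theorem theorem2p17 (K : fieldType) (charK0 : [pchar K] =i pred0) (lam : K)
    (A : lmodType K) (mul : A -> A -> A) (I : A -> A)
    (hA : is_rb_jacobi_jordan lam mul I)
    (V : lmodType K) (rho : A -> V -> V) (T : V -> V)
    (hV : is_rb_representation lam mul I rho T) :
  (forall (x : A) (u : V), T (rb_action lam I rho T x u) = rho (I x) (T u))
  /\ (is_rb_jacobi_jordan lam (rb_mul lam mul I) I
      /\ is_rb_representation lam (rb_mul lam mul I) I
           (rb_action lam I rho T) T).
Proof.
split; first exact: rb_action_intertwine hV.
split; first exact: rb_mul_rb_jacobi_jordan.
exact: rb_action_rb_representation (rbjj_rota_baxter hA) hV.
Qed.
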